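(* Let $p$ be a prime and let $\mathcal{F}$ be a fusion system over a finite $p$-group $S$. If $\mathcal{T}$ is a transporter system associated to $\mathcal{F}$, then every morphism in $\mathcal{T}$ is a composite of restrictions of automorphisms (in $\mathcal{T}$) of $S$ or of $\mathcal{T}$-essential subgroups.
   Context: Transporter systems (Oliver–Ventura). For $P,Q\le S$ put $T_S(P,Q)=\{g\in S\mid gPg^{-1}\le Q\}$, and for a set $\Delta$ of subgroups of $S$ let $\mathcal{T}_\Delta(S)$ be the category with object set $\Delta$, morphism sets $T_S(P,Q)$, and composition given by multiplication in $S$. Let $\mathcal{F}$ be a fusion system over $S$. A transporter system associated to $\mathcal{F}$ is a nonempty finite category $\mathcal{T}$ whose object set $\mathrm{Ob}(\mathcal{T})$ is a set of subgroups of $S$ closed under $\mathcal{F}$-conjugacy and overgroups in $S$, together with functors $$\mathcal{T}_{\mathrm{Ob}(\mathcal{T})}(S)\xrightarrow{\ \varepsilon\ }\mathcal{T}\xrightarrow{\ \rho\ }\mathcal{F}$$ satisfying: (A1) $\varepsilon$ is the identity on objects and $\rho$ is the inclusion on objects. (A2) For $P\in\mathrm{Ob}(\mathcal{T})$ put $E(P)=\ker(\mathrm{Aut}_{\mathcal{T}}(P)\to\mathrm{Aut}_{\mathcal{F}}(P))$. For all $P,Q\in\mathrm{Ob}(\mathcal{T})$, $E(P)$ acts freely on $\mathrm{Mor}_{\mathcal{T}}(P,Q)$ by right composition and $\rho_{P,Q}:\mathrm{Mor}_{\mathcal{T}}(P,Q)\to\mathrm{Hom}_{\mathcal{F}}(P,Q)$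 is the orbit map for this action; also $E(Q)$ acts freely on $\mathrm{Mor}_{\mathcal{T}}(P,Q)$ by left composition. (B) For all $P,Q\in\mathrm{Ob}(\mathcal{T})$, $\varepsilon_{P,Q}:T_S(P,Q)\to\mathrm{Mor}_{\mathcal{T}}(P,Q)$ is injective, and $\rho_{P,Q}\circ\varepsilon_{P,Q}$ sends $g$ to the conjugation map $x\mapsto gxg^{-1}$. (C) For all $\varphi\in\mathrm{Mor}_{\mathcal{T}}(P,Q)$ and $g\in P$, $\varphi\circ\varepsilon_{P,P}(g)=\varepsilon_{Q,Q}(\rho(\varphi)(g))\circ\varphi$. (I) $\varepsilon_{S,S}(S)$ is a Sylow $p$-subgroup of $\mathrm{Aut}_{\mathcal{T}}(S)$. (II) If $\varphi\in\mathrm{Iso}_{\mathcal{T}}(P,Q)$, $P\trianglelefteq\bar P\le S$, $Q\trianglelefteq\bar Q\le S$ and $\varphi\circ\varepsilon_{P,P}(\bar P)\circ\varphi^{-1}\le\varepsilon_{Q,Q}(\bar Q)$, then there is $\bar\varphi\in\mathrm{Mor}_{\mathcal{T}}(\bar P,\bar Q)$ with $\bar\varphi\circ\varepsilon_{P,\bar P}(1)=\varepsilon_{Q,\bar Q}(1)\circ\varphi$. For $P\in\mathrm{Ob}(\mathcal{T})$, the groups $P\le N_S(P)$ are identified with their images under $\varepsilon_{P,P}$ in $\mathrm{Aut}_{\mathcal{T}}(P)$; by (C), $P$ is normal in $\mathrm{Aut}_{\mathcal{T}}(P)$. Restrictions: for $P,P'\le Q$ in $\mathrm{Ob}(\mathcal{T})$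 and $\alpha\in\mathrm{Aut}_{\mathcal{T}}(Q)$, a morphism $\varphi\in\mathrm{Mor}_{\mathcal{T}}(P,P')$ is a restriction of $\alpha$ if $\varepsilon_{P',Q}(1)\circ\varphi=\alpha\circ\varepsilon_{P,Q}(1)$. A subgroup $H$ of a finite group $G$ is strongly $p$-embedded if $H<G$ (proper), $p$ divides $|H|$, and for every $g\in G\smallsetminus H$, $p$ does not divide $|H\cap H^g|$, where $H^g=g^{-1}Hg$. A subgroup $P\in\mathrm{Ob}(\mathcal{T})$ is $\mathcal{T}$-essential if (i) $N_S(P)$ is a Sylow $p$-subgroup of $\mathrm{Aut}_{\mathcal{T}}(P)$, and (ii) $\mathrm{Aut}_{\mathcal{T}}(P)/P$ contains a strongly $p$-embedded subgroup. *)

(* Defs.v *)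
From HB Require Import structures.
Set Warnings "-notation-overridden,-redundant-canonical-projection".
Set Warnings "-projection-no-head-constant".
From mathcomp Require Import all_boot all_fingroup all_solvable.

Set Implicit Arguments.
Unset Strict Implicit.
Unset Printing Implicit Defensive.

Import GroupScope.

(* Categories with object type O and finite morphism sets.  Composition is in
   the usual right-to-left order: g \oc f is "f, then g". *)
Record fincat (O : Type) := FinCat {
  mor : O -> O -> finType;
  cid : forall x, mor x x;
  ccomp : forall x y z, mor y z -> mor x y -> mor x z;
  ccompA : forall x y z t (h : mor z t) (g : mor y z) (f : mor x y),
    ccomp h (ccomp g f) = ccomp (ccomp h g) f;
  ccomp1m : forall x y (f : mor x y), ccomp (cid y) f = f;
  ccompm1 : forall x y (f : mor x y), ccomp f (cid x) = f }.

Arguments cid {O} C x : rename.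
Arguments ccomp {O C x y z} g f : rename.

Notation "g \oc f" := (ccomp g f)
  (at level 40, left associativity, format "g  \oc  f").

Definition inverses O (C : fincat O) x y (f : mor C x y) (g : mor C y x) :=
  (g \oc f == cid C x) && (f \oc g == cid C y).

(* Functors that are the identity on objects. *)
Record idfunctor O (C D : fincat O) := IdFunctor {
  fmap :> forall x y, mor C x y -> mor D x y;
  fmap_id : forall x, fmap (cid C x) = cid D x;
  fmap_comp : forall x y z (g : mor C y z) (f : mor C x y),
    fmap (g \oc f) = fmap g \oc fmap f }.

Arguments fmap {O C D} F {x y} f : rename.

Section AutGroup.
Variables (O : Type) (C : fincat O) (x : O).

Record aut : predArgType := Aut {
  aut_mor :> mor C x x;
  aut_inv_ex : [exists g, inverses aut_mor g] }.

HB.instance Definition _ := [isSub for aut_mor].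
#[hnf] HB.instance Definition _ := [Finite of aut by <:].

Fact aut_one_subproof : [exists g, inverses (cid C x) g].
Proof. by apply/existsP; exists (cid C x); rewrite /inverses ccomp1m eqxx. Qed.
Definition aut_one := Aut aut_one_subproof.

Fact aut_mul_subproof (a b : aut) : [exists g, inverses (a \oc b) g].
Proof.
case: a b => [a /= /existsP[a' /andP[/eqP a'a /eqP aa']]].
case=> [b /= /existsP[b' /andP[/eqP b'b /eqP bb']]].
apply/existsP; exists (b' \oc a'); rewrite /inverses; apply/andP; split.
  by rewrite ccompA -(ccompA b') a'a ccompm1 b'b.
by rewrite ccompA -(ccompA a) bb' ccompm1 aa'.
Qed.
Definition aut_mul a b := Aut (aut_mul_subproof a b).

Fact aut_inv_subproof (a : aut) :
  [exists g, inverses (xchoose (existsP (aut_inv_ex a))) g].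
Proof.
apply/existsP; exists (aut_mor a); rewrite /inverses andbC.
exact: (xchooseP (existsP (aut_inv_ex a))).
Qed.
Definition aut_inv a := Aut (aut_inv_subproof a).

Fact aut_mulA : associative aut_mul.
Proof. by move=> a b c; apply: val_inj; apply: ccompA. Qed.
Fact aut_mul1 : left_id aut_one aut_mul.
Proof. by move=> a; apply: val_inj; apply: ccomp1m. Qed.
Fact aut_mulV : left_inverse aut_one aut_inv aut_mul.
Proof.
move=> a; apply: val_inj; apply/eqP.
by case/andP: (xchooseP (existsP (aut_inv_ex a))).
Qed.

HB.instance Definition _ := Finite_isGroup.Build aut aut_mulA aut_mul1 aut_mulV.

Lemma aut1E : (1 : aut) = cid C x :> mor C x x. Proof. by []. Qed.
Lemma autME (a b : aut) : a * b = a \oc b :> mor C x x. Proof. by []. Qed.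

End AutGroup.

Section FunctorAut.
Variables (O : Type) (C D : fincat O) (F : idfunctor C D) (x : O).

Fact faut_subproof (a : aut C x) : [exists g, inverses (fmap F a) g].
Proof.
case: a => a /= /existsP[b /andP[/eqP ba /eqP ab]].
by apply/existsP; exists (fmap F b);
  rewrite /inverses -!fmap_comp ba ab fmap_id eqxx.
Qed.
Definition faut (a : aut C x) : aut D x := Aut (faut_subproof a).

Fact faut_morphM : {in [set: aut C x] &, {morph faut : a b / a * b}}.
Proof. by move=> a b _ _; apply: val_inj; apply: fmap_comp. Qed.
Canonical faut_morphism := Morphism faut_morphM.
End FunctorAut.

Arguments faut {O C D} F x a.

(* T_S(P, Q) is the set of g \in S with g P g^-1 \subset Q; recall that
   A :^ x is x^-1 A x. *)
Definition transp (gT : finGroupType) (S P Q : {set gT}) : {set gT} :=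
  [set g in S | P :^ g^-1 \subset Q].

Section Maps.
Variable gT : finGroupType.
Implicit Types (P Q : {set gT}) (f g : {ffun gT -> gT}).

(* A map P -> Q between subgroups of gT is encoded as the finite function on gT
   extending it by 1 outside P.  With this convention an inclusion has the same
   underlying function as the identity, and composition in the category of
   groups is composition of functions. *)
Definition inj_hom P Q f : Prop :=
  [/\ {in P &, {morph f : x y / x * y}}, {in P &, injective f},
      f @: P \subset Q & {in ~: P, forall x, f x = 1}].

Definition id_map P : {ffun gT -> gT} := [ffun x => if x \in P then x else 1].
Definition comp_map g f : {ffun gT -> gT} := [ffun x => g (f x)].
Definition conj_map P (g : gT) : {ffun gT -> gT} :=
  [ffun x => if x \in P then g * x * g^-1 else 1].
End Maps.

(* Fusion systems, not assumed saturated: fhom P Q is Hom_F(P, Q), and is only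
   meaningful for P, Q \subset S.  The last axiom says that every morphism is
   an isomorphism of F onto a subgroup R of Q followed by an inclusion. *)
Record fusion_system (gT : finGroupType) (S : {group gT}) := FusionSystem {
  fhom : {group gT} -> {group gT} -> {set {ffun gT -> gT}};
  fhom_inj : forall P Q : {group gT}, P \subset S -> Q \subset S ->
    forall f, f \in fhom P Q -> inj_hom P Q f;
  fhom_conj : forall P Q : {group gT}, P \subset S -> Q \subset S ->
    forall g, g \in transp S P Q -> conj_map P g \in fhom P Q;
  fhom_comp : forall P Q R : {group gT},
    P \subset S -> Q \subset S -> R \subset S ->
    forall f g, f \in fhom P Q -> g \in fhom Q R -> comp_map g f \in fhom P R;
  fhom_fact : forall P Q : {group gT}, P \subset S -> Q \subset S ->
    forall f, f \in fhom P Q ->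
    exists R : {group gT}, exists g,
      [/\ R \subset Q, f \in fhom P R, g \in fhom R P,
          comp_map g f = id_map P & comp_map f g = id_map R] }.

Definition fconjugate (gT : finGroupType) (S : {group gT})
    (F : fusion_system S) (P Q : {group gT}) : Prop :=
  exists f, exists g, [/\ f \in fhom F P Q, g \in fhom F Q P,
    comp_map g f = id_map P & comp_map f g = id_map Q].

Record object_set (gT : finGroupType) (S : {group gT}) (F : fusion_system S) :=
  ObjectSet {
  objects : {set {group gT}};
  objects_neq0 : objects != set0;
  objects_sub : objects \subset subgroups S;
  objects_conj : forall P Q : {group gT}, P \in objects -> Q \subset S ->
    fconjugate F P Q -> Q \in objects;
  objects_over : forall P Q : {group gT}, P \in objects -> P \subset Q ->
    Q \subset S -> Q \in objects }.

Section Objects.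
Variables (gT : finGroupType) (S : {group gT}) (F : fusion_system S).
Variable D : object_set F.

Record object := Object { obj_gval :> {group gT}; objP : obj_gval \in objects D }.

Lemma obj_sub (P : object) : P \subset S.
Proof. by have := subsetP (objects_sub D) _ (objP P); rewrite inE. Qed.

Fact top_obj_subproof : S \in objects D.
Proof.
have /set0Pn[P DP] := objects_neq0 D.
by apply: (objects_over DP) => //; apply: (obj_sub (Object DP)).
Qed.
Definition top_obj : object := Object top_obj_subproof.

Record tmor (P Q : object) : predArgType := TMor {
  tval :> gT; tvalP : tval \in transp S P Q }.
HB.instance Definition _ P Q := [isSub for @tval P Q].
#[hnf] HB.instance Definition _ P Q := [Finite of tmor P Q by <:].

Fact tid_subproof (P Q : object) : P \subset Q -> 1 \in transp S P Q.
Proof. by move=> sPQ; rewrite inE group1 invg1 conjsg1. Qed.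
(* The element 1, as an element of T_S(P, Q) when P \subset Q. *)
Definition tincl (P Q : object) (sPQ : P \subset Q) : tmor P Q :=
  TMor (tid_subproof sPQ).

Fact tcomp_subproof P Q R (h : tmor Q R) (g : tmor P Q) :
  tval h * tval g \in transp S P R.
Proof.
case: h g => h /= /setIdP[Sh sQR] [g /= /setIdP[Sg sPQ]].
rewrite inE groupM //= invMg conjsgM (subset_trans _ sQR) //.
by rewrite conjSg.
Qed.
Definition tcomp P Q R (h : tmor Q R) (g : tmor P Q) : tmor P R :=
  TMor (tcomp_subproof h g).

Fact tinner_subproof (P : object) x : x \in P -> x \in transp S P P.
Proof.
move=> Px; rewrite inE (subsetP (obj_sub P)) //= conjGid ?groupV //.
Qed.
Definition tinner (P : object) x (Px : x \in P) : tmor P P :=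
  TMor (tinner_subproof Px).

Definition transporter_cat : fincat object.
Proof.
refine (@FinCat object (fun P Q => tmor P Q) (fun P => tincl (subxx P)) tcomp
  _ _ _).
- by move=> P Q R U h g f; apply: val_inj; apply: mulgA.
- by move=> P Q f; apply: val_inj; apply: mul1g.
- by move=> P Q f; apply: val_inj; apply: mulg1.
Defined.

Record fmor (P Q : object) : predArgType := FMor {
  fval :> {ffun gT -> gT}; fvalP : fval \in fhom F P Q }.
HB.instance Definition _ P Q := [isSub for @fval P Q].
#[hnf] HB.instance Definition _ P Q := [Finite of fmor P Q by <:].

Lemma fmor_inj_hom (P Q : object) (f : fmor P Q) : inj_hom P Q f.
Proof. exact: (fhom_inj (obj_sub P) (obj_sub Q) (fvalP f)). Qed.

Lemma fmor_in (P Q : object) (f : fmor P Q) x : x \in P -> f x \in Q.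
Proof.
move=> Px; case: (fmor_inj_hom f) => _ _ /subsetP sfPQ _.
exact/sfPQ/imset_f.
Qed.

Fact fid_subproof (P : object) : id_map P \in fhom F P P.
Proof.
have -> : id_map P = conj_map P 1.
  by apply/ffunP=> x; rewrite !ffunE invg1 mulg1 mul1g.
apply: fhom_conj; rewrite ?obj_sub //; exact: (tid_subproof (subxx P)).
Qed.
Definition fid (P : object) : fmor P P := FMor (fid_subproof P).

Definition fcomp P Q R (g : fmor Q R) (f : fmor P Q) : fmor P R :=
  FMor (fhom_comp (obj_sub P) (obj_sub Q) (obj_sub R) (fvalP f) (fvalP g)).

(* The full subcategory of F on the objects in D. *)
Definition fusion_cat : fincat object.
Proof.
refine (@FinCat object (fun P Q => fmor P Q) fid fcomp _ _ _).
- by move=> P Q R U h g f; apply: val_inj; apply/ffunP=> x; rewrite !ffunE.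
- move=> P Q f; apply: val_inj; apply/ffunP=> x; rewrite !ffunE.
  case: ifPn => // notQfx; have [Px|notPx] := boolP (x \in P).
    by rewrite fmor_in in notQfx.
  by case: (fmor_inj_hom f) => _ _ _ -> //; rewrite inE.
- move=> P Q f; apply: val_inj; apply/ffunP=> x; rewrite !ffunE.
  case: ifPn => // notPx; case: (fmor_inj_hom f) => fM _ _ f1.
  rewrite [RHS]f1 ?inE //; apply: (mulgI (f 1)).
  by rewrite -fM ?group1 // !mulg1.
Defined.

Definition taut_val P (a : aut transporter_cat P) : gT := tval (aut_mor a).

Fact taut_val_morphM P :
  {in [set: aut transporter_cat P] &, {morph @taut_val P : a b / a * b}}.
Proof. by []. Qed.
Canonical taut_val_morphism P := Morphism (@taut_val_morphM P).

(* Aut_{T_D(S)}(P) is N_S(P). *)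
Lemma im_taut_val (P : object) :
  @taut_val P @* [set: aut transporter_cat P] = 'N_S(P).
Proof.
apply/setP=> g; rewrite morphimEdom; apply/imsetP/setIP.
  case=> a _ ->; rewrite /taut_val; have /setIdP[Sa sPa] := tvalP (aut_mor a).
  by split=> //; rewrite -groupV inE.
case=> Sg Ng.
have tg : g \in transp S P P by rewrite inE Sg (normP (groupVr Ng)) /=.
have tg' : g^-1 \in transp S P P by rewrite inE groupV Sg invgK (normP Ng) /=.
have ag : [exists h : mor transporter_cat P P,
    @inverses _ transporter_cat P P (TMor tg : tmor P P) h].
  apply/existsP; exists (TMor tg' : tmor P P); apply/andP.
  by split; apply/eqP/val_inj; rewrite /= ?mulVg ?mulgV.
by exists (Aut ag).
Qed.

End Objects.

Arguments taut_val {gT S F D} P a.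

Section TransporterLaws.
Variables (gT : finGroupType) (S : {group gT}) (F : fusion_system S).
Variables (D : object_set F) (T : fincat (object D)).
Variables (eps : idfunctor (transporter_cat D) T).
Variables (rho : idfunctor T (fusion_cat D)).
Implicit Types P Q : object D.

Definition eps_val P Q (g : tmor P Q) : mor T P Q := @fmap _ _ _ eps P Q g.
Definition rho_val P Q (f : mor T P Q) : fmor P Q := @fmap _ _ _ rho P Q f.

(* The image under eps_{P,P} of the elements of A lying in N_S(P). *)
Definition eps_im P (A : {set gT}) : {set aut T P} :=
  faut eps P @* (taut_val P @*^-1 A).

(* E(P), the kernel of Aut_T(P) -> Aut_F(P). *)
Definition kerE P : {set aut T P} := 'ker (faut rho P).

Definition axiomA2 : Prop := forall P Q,
  [/\ forall (a : aut T P) (f : mor T P Q),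
        a \in kerE P -> f \oc a = f -> a = 1,
      forall h : fmor P Q, exists f : mor T P Q, rho_val f = h,
      forall f f' : mor T P Q,
        rho_val f = rho_val f' <-> (exists2 a, a \in kerE P & f' = f \oc a)
    & forall (b : aut T Q) (f : mor T P Q),
        b \in kerE Q -> b \oc f = f -> b = 1].

Definition axiomB : Prop := forall P Q,
  injective (@eps_val P Q) /\
  (forall g : tmor P Q, rho_val (eps_val g) = conj_map P g :> {ffun gT -> gT}).

Definition axiomC : Prop := forall P Q (f : mor T P Q) x (Px : x \in P),
  f \oc eps_val (tinner Px) =
  eps_val (tinner (fmor_in (rho_val f) Px)) \oc f.

Definition axiomI (p : nat) : Prop :=
  p.-Sylow([set: aut T (top_obj D)]) (eps_im (top_obj D) S).

Definition axiomII : Prop :=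
  forall P Q (P' Q' : object D) (nPP' : P <| P') (nQQ' : Q <| Q')
    (f : mor T P Q) (f' : mor T Q P), inverses f f' ->
    (forall g : tmor P P, tval g \in P' -> exists2 h : tmor Q Q,
       tval h \in Q' & f \oc eps_val g \oc f' = eps_val h) ->
    exists fbar : mor T P' Q',
      fbar \oc eps_val (tincl (normal_sub nPP')) =
      eps_val (tincl (normal_sub nQQ')) \oc f.

End TransporterLaws.

Record transporter_system (gT : finGroupType) (p : nat) (S : {group gT})
    (F : fusion_system S) := TransporterSystem {
  tobj : object_set F;
  tcat : fincat (object tobj);
  teps : idfunctor (transporter_cat tobj) tcat;
  trho : idfunctor tcat (fusion_cat tobj);
  tsA2 : axiomA2 trho;
  tsB : axiomB teps trho;
  tsC : axiomC teps trho;
  tsI : axiomI teps p;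
  tsII : axiomII teps }.

Definition strongly_embedded (gT : finGroupType) (p : nat) (G H : {set gT}) :=
  [&& H \proper G, p %| #|H| & [forall g in G :\: H, ~~ (p %| #|H :&: H :^ g|)]].

Section Essential.
Variables (gT : finGroupType) (p : nat) (S : {group gT}).
Variables (F : fusion_system S) (T : transporter_system p F).
Implicit Types P Q R : object (tobj T).

(* N_S(P) and P are identified with their images in Aut_T(P). *)
Definition essential P : Prop :=
  p.-Sylow([set: aut (tcat T) P]) (eps_im (teps T) P 'N_S(P)) /\
  exists H : {group coset_of (eps_im (teps T) P P)},
    strongly_embedded p ([set: aut (tcat T) P] / eps_im (teps T) P P) H.

Definition is_restriction P Q R (a : aut (tcat T) R) (f : mor (tcat T) P Q) :=
  exists (sPR : P \subset R) (sQR : Q \subset R),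
    eps_val (teps T) (tincl sQR) \oc f = a \oc eps_val (teps T) (tincl sPR).

(* Composites of restrictions of automorphisms of objects satisfying X. *)
Inductive comp_of_restr (X : object (tobj T) -> Prop) :
  forall P Q, mor (tcat T) P Q -> Prop :=
| Restr P Q R (a : aut (tcat T) R) (f : mor (tcat T) P Q) of
    X R & is_restriction a f : comp_of_restr X f
| CompRestr P Q R (g : mor (tcat T) Q R) (f : mor (tcat T) P Q) of
    comp_of_restr X g & comp_of_restr X f : comp_of_restr X (g \oc f).

End Essential.

(* Main.v *)
Require Import Defs.
From mathcomp Require Import all_boot all_fingroup all_solvable.

Set Implicit Arguments.
Unset Strict Implicit.
Unset Printing Implicit Defensive.

Import GroupScope.

Import Defs.

(* Alperin's fusion argument, by downward induction on the order of the source.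
   Morphisms of T are monomorphisms and factor as an isomorphism followed by an
   inclusion, so only isomorphisms matter; one that extends to a strictly
   larger object is handled by induction, and so is its inverse.
   Every object is isomorphic to some Q with N_S(Q) Sylow in Aut_T(Q): if
   N_S(P) is not Sylow, a larger p-subgroup M of Aut_T(P) normalizing N_S(P)
   lifts to Aut_T(N_S(P)) by axiom (II), hence, by induction and Sylow's
   theorem, can be conjugated into S, which yields an isomorphic object with a
   larger normalizer.  By Sylow and (II) again every object P < S has an isomorphism to
   such a Q that extends to N_S(P), which leaves the automorphisms of Q.
   Those a for which some Q < Y <= N_S(Q) has a Y a^-1 <= N_S(Q) extend to Y;
   they generate a subgroup H of Aut_T(Q), and if H is proper then H/Q is
   strongly p-embedded, so that Q is itself essential. *)

(** * Isomorphisms in a category and conjugation of automorphism groups *)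

Section IsoCategory.
Variables (O : Type) (C : fincat O).

Lemma inverses_sym x y (f : mor C x y) g : inverses f g -> inverses g f.
Proof. by rewrite /inverses andbC. Qed.

Lemma inverses_comp x y z (f : mor C x y) f' (g : mor C y z) g' :
  inverses f f' -> inverses g g' -> inverses (g \oc f) (f' \oc g').
Proof.
case/andP=> /eqP f'f /eqP ff' /andP[/eqP g'g /eqP gg']; apply/andP; split.
  by rewrite ccompA -(ccompA f') g'g ccompm1 f'f.
by rewrite ccompA -(ccompA g) ff' ccompm1 gg'.
Qed.

Lemma iso_epi x y z (u : mor C x y) u' (f g : mor C y z) :
  inverses u u' -> f \oc u = g \oc u -> f = g.
Proof.
case/andP=> _ /eqP uu' /(congr1 (fun h => h \oc u')).
by rewrite -!ccompA uu' !ccompm1.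
Qed.

Lemma inverses_id x : inverses (cid C x) (cid C x).
Proof. by rewrite /inverses ccomp1m eqxx. Qed.

Lemma aut_inverses x (a : aut C x) : inverses a (aut_mor a^-1).
Proof. exact: (xchooseP (existsP (aut_inv_ex a))). Qed.

Lemma aut_of_inverses x (f : mor C x x) g :
  inverses f g -> exists a : aut C x, aut_mor a = f /\ aut_mor a^-1 = g.
Proof.
move=> fg; have ex : [exists g, inverses f g] by apply/existsP; exists g.
exists (Aut ex); split=> //.
have /andP[/eqP vf _] := aut_inverses (Aut ex); have /andP[_ /eqP fgE] := fg.
by rewrite -[LHS]ccompm1 -fgE ccompA vf ccomp1m.
Qed.

Section Conj.
Variables (x y : O) (f : mor C x y) (f' : mor C y x).
Hypothesis ff' : inverses f f'.

Fact iso_conj_subproof (a : aut C x) :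
  [exists g, inverses (f \oc a \oc f') g].
Proof.
apply/existsP; exists (f \oc (aut_mor a^-1 \oc f')).
exact: inverses_comp (inverses_sym ff') (inverses_comp (aut_inverses a) ff').
Qed.
Definition iso_conj a : aut C y := Aut (iso_conj_subproof a).

Fact iso_conj_morphM :
  {in [set: aut C x] &, {morph iso_conj : a b / a * b}}.
Proof.
have /andP[/eqP f'f _] := ff'.
move=> a b _ _; apply: val_inj => /=.
by rewrite !ccompA -(ccompA _ f') f'f ccompm1.
Qed.
Canonical iso_conj_morphism := Morphism iso_conj_morphM.

Lemma injm_iso_conj : 'injm iso_conj.
Proof.
have /andP[/eqP f'f _] := ff'.
apply/injmP=> a b _ _ /(congr1 (@aut_mor _ _ _)) /=.
move/(congr1 (fun h => f' \oc h \oc f)); rewrite !ccompA f'f !ccomp1m.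
by rewrite -!ccompA f'f !ccompm1 => /val_inj.
Qed.
End Conj.
End IsoCategory.

(** Suppose p divides |K : E| for K = H :&: H :^ y with y in G. A Sylow p-subgroup X of K then
    properly contains E, and both X and its conjugate by y^-1 lie in H, hence in H-conjugates of N.
    The hypothesis on fusion in N puts the element carrying one copy in N to the other into H, which
    forces y into H. *)
Lemma strongly_embedded_quotient (hT : finGroupType) (p : nat)
    (G E N H : {group hT}) :
    prime p -> E <| G -> E \proper N -> p.-Sylow(G) N -> H \proper G ->
    (forall (X : {group hT}) x, E \proper X -> X \subset N -> x \in G ->
       X :^ x \subset N -> x \in H) ->
  strongly_embedded p (G / E) (H / E).
Proof.
move=> p_pr nEG ltEN sylN ltHG fus; have [sNG pN _] := and3P sylN.
have sHG := proper_sub ltHG; have sEN := proper_sub ltEN.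
have sNH : N \subset H.
  apply/subsetP=> x Nx; apply: (fus N) => //; first exact: (subsetP sNG).
  by rewrite conjGid.
have sEH := subset_trans sEN sNH; have nEH := normalS sEH sHG nEG.
have sylNH : p.-Sylow(H) N := pHall_subl sNH sHG sylN.
have pE := pgroupS sEN pN.
apply/and3P; split.
- by rewrite quotient_proper.
- apply: dvdn_trans (cardSg (quotientS E sNH)).
  have := quotient_pgroup E pN.
  have nt : N / E != 1.
    rewrite -subG1 quotient_sub1 ?proper_subn //.
    by rewrite (subset_trans sNG) ?normal_norm.
  by move/pgroup_pdiv/(_ nt)=> [].
apply/forall_inP=> _ /setDP[/morphimP[y Ny Gy ->] notHy].
have notHy' : y \notin H.
  by apply: contra notHy => Hy; apply: mem_quotient.
apply: contra notHy' => p_dv.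
have nEy : E :^ y = E by apply: (normP Ny).
pose K := (H :&: H :^ y)%G.
have sEK : E \subset K by rewrite subsetI sEH -{1}nEy conjSg.
have sKG : K \subset G by apply: subset_trans sHG; apply: subsetIl.
have nEK : E <| K := normalS sEK sKG nEG.
have KE : H / E :&: (H / E) :^ coset E y = K / E.
  by rewrite -quotientJ // quotientGI.
rewrite KE card_quotient ?normal_norm // in p_dv.
have [X sylX] := Sylow_exists p K; have [sXK pX _] := and3P sylX.
have sEX : E \subset X by apply: normal_sub_max_pgroup (Hall_max sylX) pE nEK.
have ltEX : E \proper X.
  (* If E were itself Sylow in K, the index |K : E| would be prime to p. *)
  rewrite properEneq sEX andbT; apply: contraTneq p_dv => eqEX.
  move: sylX; rewrite -p'natE // (_ : X = E) => [/and3P[]//|].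
  by apply: val_inj.
have /subsetIP[sXH sXHy] := sXK.
have [k Hk sXk] := Sylow_subJ sylNH sXH pX.
have sXyH : (X :^ y^-1)%G \subset H by rewrite sub_conjgV.
have pXy : p.-group (X :^ y^-1)%G by rewrite pgroupJ.
have [l Hl sXl] := Sylow_subJ sylNH sXyH pXy.
have sHGx := subsetP sHG.
have: k * y^-1 * l^-1 \in H.
  apply: (fus (X :^ k^-1)%G).
  - have nEk : k^-1 \in 'N(E).
      by rewrite groupV (subsetP (normal_norm nEG)) ?sHGx.
    by rewrite -(normP nEk) properJ.
  - by rewrite sub_conjgV.
  - by rewrite !groupM ?groupV ?(sHGx k) ?(sHGx l).
  by rewrite -conjsgM !mulgA mulVg mul1g conjsgM sub_conjgV.
by rewrite groupMr ?groupV // groupMl // groupV.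
Qed.

(** * Cancellation and factorization of morphisms in a transporter system *)

Section Transporter.
Variables (p : nat) (gT : finGroupType) (S : {group gT}).
Variables (F : fusion_system S) (T : transporter_system p F).
Implicit Types P Q R N M : object (tobj T).

Local Notation Mor := (mor (tcat T)).
Local Notation ev := (eps_val (teps T)).
Local Notation inc sPQ := (ev (tincl sPQ)).
Local Notation im := (eps_im (teps T)).
Local Notation rv f := (fval (rho_val (trho T) f)).

Lemma object_inj : injective (@obj_gval _ _ _ (tobj T)).
Proof.
by case=> P DP [Q DQ] /= eqPQ; subst Q; rewrite (bool_irrelevance DP DQ).
Qed.

Lemma eps_val_comp P Q R (h : tmor Q R) (g : tmor P Q) :
  ev (tcomp h g) = ev h \oc ev g.
Proof. exact: (fmap_comp (teps T)). Qed.

Lemma eps_val_eq P Q (g h : tmor P Q) : tval g = tval h -> ev g = ev h.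
Proof. by move/val_inj->. Qed.

Lemma inc_comp P Q R (sPQ : P \subset Q) (sQR : Q \subset R)
    (sPR : P \subset R) : inc sQR \oc inc sPQ = inc sPR.
Proof. by rewrite -eps_val_comp; apply: eps_val_eq; rewrite /= mulg1. Qed.

Lemma eps_val1 P (g : tmor P P) : tval g = 1 -> ev g = cid _ P.
Proof. by rewrite -(fmap_id (teps T)) => g1; apply: eps_val_eq. Qed.

Lemma rv_comp P Q R (g : Mor Q R) (f : Mor P Q) x :
  rv (g \oc f) x = rv g (rv f x).
Proof. by rewrite /rho_val fmap_comp /= ffunE. Qed.

Lemma rv_eps P Q (g : tmor P Q) x :
  x \in P -> rv (ev g) x = tval g * x * (tval g)^-1.
Proof. by move=> Px; rewrite (tsB P Q).2 ffunE Px. Qed.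

Lemma rv_inc P Q (sPQ : P \subset Q) x : x \in P -> rv (inc sPQ) x = x.
Proof. by move=> Px; rewrite rv_eps // mul1g invg1 mulg1. Qed.

Lemma rv_id P x : x \in P -> rv (cid (tcat T) P) x = x.
Proof. by move=> Px; rewrite -(@eps_val1 P (tincl (subxx P))) // rv_inc. Qed.

Lemma rv_in P Q (f : Mor P Q) x : x \in P -> rv f x \in Q.
Proof. exact: fmor_in. Qed.

Lemma rv_inj P Q (f : Mor P Q) : {in P &, injective (rv f)}.
Proof. by case: (fmor_inj_hom (rho_val (trho T) f)). Qed.

Lemma rv_out P Q (f : Mor P Q) x : x \notin P -> rv f x = 1.
Proof.
by move=> nPx; case: (fmor_inj_hom (rho_val (trho T) f)) => _ _ _ ->;
  rewrite ?inE.
Qed.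

Lemma eq_rho P Q (f g : Mor P Q) : {in P, rv f =1 rv g} ->
  exists2 a, a \in kerE (trho T) P & g = f \oc a.
Proof.
move=> eqfg; have [_ _ h _] := tsA2 P Q; apply/h/val_inj/ffunP=> x.
by have [/eqfg // | nPx] := boolP (x \in P); rewrite !rv_out.
Qed.

(** Since [rho] of h is injective, f and g have the same image under [rho], so g is f followed on
    the right by some a in E(P). Then a fixes h \oc f, and the freeness of the right action of E(P)
    gives a = 1. *)
Lemma mor_mono P Q R (h : Mor Q R) (f g : Mor P Q) :
  h \oc f = h \oc g -> f = g.
Proof.
move=> eqhfg; have [|a Ea def_g] := @eq_rho _ _ f g.
  move=> x Px; apply: (@rv_inj _ _ h); rewrite ?rv_in //.
  by rewrite -!rv_comp eqhfg.
have [free _ _ _] := tsA2 P R.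
by rewrite def_g (free a (h \oc f)) ?aut1E ?ccompm1 // -ccompA -def_g.
Qed.

Lemma inverses_rv P Q (f : Mor P Q) f' x :
  inverses f f' -> x \in P -> rv f' (rv f x) = x.
Proof. by case/andP=> /eqP f'f _ Px; rewrite -rv_comp f'f rv_id. Qed.

Lemma leq_card_mor P Q (f : Mor P Q) : #|P| <= #|Q|.
Proof.
rewrite -(card_in_imset (@rv_inj _ _ f)); apply: subset_leq_card.
by apply/subsetP=> _ /imsetP[x Px ->]; apply: rv_in.
Qed.

Lemma card_iso P Q (f : Mor P Q) (f' : Mor Q P) : #|P| = #|Q|.
Proof. by apply/eqP; rewrite eqn_leq (leq_card_mor f) (leq_card_mor f'). Qed.

(** The factorization in the fusion system lifts because [rho] is onto. The lifts g, g' compose to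
    some a in E(P), which a^-1 corrects; the left inverse so obtained is two-sided by left
    cancellation. The lifted composite differs from f by an element b of E(P), which is absorbed
    into g. *)
Lemma mor_factor P Q (f : Mor P Q) :
  exists R (sRQ : R \subset Q) (g : Mor P R) (g' : Mor R P),
    inverses g g' /\ f = inc sRQ \oc g.
Proof.
have [R0 [h' [sRQ hPR hRP h'h hh']]] :=
  fhom_fact (obj_sub P) (obj_sub Q) (fvalP (rho_val (trho T) f)).
have DR : R0 \in objects (tobj T).
  apply: (objects_conj (objP P)); first exact: subset_trans (obj_sub Q).
  by exists (rv f), h'.
pose R := Object DR; exists R.
have {}sRQ : R \subset Q by [].
exists sRQ.
have [_ /(_ (@FMor _ _ _ _ P R _ hPR))[g def_g] _ _] := tsA2 P R.
have [_ /(_ (@FMor _ _ _ _ R P _ hRP))[g' def_g'] _ _] := tsA2 R P.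
have rv_g : rv g = rv f by rewrite def_g.
have rv_g' : rv g' = h' by rewrite def_g'.
have [|a Ea] := @eq_rho _ _ (cid _ P) (g' \oc g).
  move=> x Px; rewrite rv_id // rv_comp rv_g rv_g'.
  by move/ffunP/(_ x): h'h; rewrite !ffunE Px.
rewrite ccomp1m => g'g; have aV := aut_inverses a.
have kg : aut_mor a^-1 \oc g' \oc g = cid _ P.
  by rewrite -ccompA g'g; case/andP: aV => /eqP.
have gk : inverses g (aut_mor a^-1 \oc g').
  apply/andP; rewrite kg eqxx; split=> //; apply/eqP.
  apply: (@mor_mono _ _ _ (aut_mor a^-1 \oc g')).
  by rewrite ccompA kg ccomp1m ccompm1.
have [|b Eb ->] := @eq_rho _ _ (inc sRQ \oc g) f.
  by move=> x Px; rewrite rv_comp rv_inc ?rv_in // rv_g.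
exists (g \oc b), (aut_mor b^-1 \oc (aut_mor a^-1 \oc g')).
by split; [apply: inverses_comp (aut_inverses b) gk | rewrite ccompA].
Qed.

(** Each x in N acts on P, and axiom (C) expresses the restriction of f precomposed with x through
    [rho] of f at x. Cancelling the isomorphism onto the image, injectivity of [eps] shows that f
    and g have the same underlying map on N. They differ by an element of E(N) that fixes the
    inclusion of P, and the left action of E(N) is free. *)
Lemma inc_epi P N Q (nPN : P <| N) (sPN : P \subset N) (f g : Mor N Q) :
  f \oc inc sPN = g \oc inc sPN -> f = g.
Proof.
move=> eq_fg.
have [R [sRQ [u [u' [uu' fE]]]]] := mor_factor (f \oc inc sPN).
have [|a Ea def_g] := @eq_rho _ _ f g.
  move=> x Nx; have tx : x \in transp S P P.
    rewrite inE (subsetP (obj_sub N)) //=.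
    by rewrite (normsP (normal_norm nPN)) ?groupV.
  have inner (h : Mor N Q) : h \oc inc sPN \oc ev (TMor tx : tmor P P) =
      ev (tinner (rv_in h Nx)) \oc (h \oc inc sPN).
    rewrite -ccompA -eps_val_comp.
    rewrite (@eps_val_eq _ _ _ (tcomp (tinner Nx) (tincl sPN))).
      rewrite eps_val_comp !ccompA (tsC h); congr (_ \oc _ \oc _).
      exact: eps_val_eq.
    by rewrite /= mulg1 mul1g.
  have := inner g; rewrite -eq_fg inner fE !ccompA => /(iso_epi uu').
  rewrite -!eps_val_comp => /(tsB R Q).1 /(congr1 (@tval _ _ _ _ _ _)).
  by rewrite /= !mulg1.
have [_ _ _ free] := tsA2 P N.
rewrite def_g (free a (inc sPN)) ?aut1E ?ccompm1 //.
by apply: (@mor_mono _ _ _ f); rewrite ccompA -def_g.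
Qed.

Lemma extend_iso P N Q M (nPN : P <| N) (nQM : Q <| M)
    (sPN : P \subset N) (sQM : Q \subset M) (f : Mor P Q) f' :
    inverses f f' ->
    (forall g : tmor P P, tval g \in N -> exists2 h : tmor Q Q,
       tval h \in M & f \oc ev g \oc f' = ev h) ->
  exists fbar : Mor N M, fbar \oc inc sPN = inc sQM \oc f.
Proof.
move=> ff' fNM; have [fbar fbarE] := tsII nPN nQM ff' fNM.
exists fbar; rewrite (bool_irrelevance sPN (normal_sub nPN)) fbarE.
by rewrite (bool_irrelevance sQM (normal_sub nQM)).
Qed.

(** * The copies of P and N_S(P) in Aut_T(P) *)

Lemma tmor_norm P (g : tmor P P) : tval g \in 'N_S(P).
Proof. by have /setIdP[Sg] := tvalP g; rewrite inE Sg -groupV inE. Qed.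

Lemma eps_imP P (A : {set gT}) (a : aut (tcat T) P) :
  reflect (exists2 g : tmor P P, tval g \in A & aut_mor a = ev g)
          (a \in im P A).
Proof.
apply: (iffP morphimP) => [[b _] | [g Ag aE]].
  by rewrite !inE /= => Ab ->; exists (aut_mor b).
have := tmor_norm g; rewrite -im_taut_val => /morphimP[b _ _ bE].
have bgE : aut_mor b = g by apply: val_inj.
exists b; rewrite ?inE //=; first by rewrite -bE.
by apply: val_inj; rewrite /= aE bgE.
Qed.

Lemma aut_eps P (g : tmor P P) : exists a : aut (tcat T) P, aut_mor a = ev g.
Proof.
have := tmor_norm g; rewrite -im_taut_val => /morphimP[b _ _ bE].
exists (faut (teps T) P b); rewrite /= (_ : aut_mor b = g) //.
exact: val_inj.
Qed.

Lemma injm_faut_eps P : 'injm (faut (teps T) P).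
Proof.
apply/injmP=> a b _ _ /(congr1 (@aut_mor _ _ _)) /= eq_ab.
by apply: val_inj; apply: (tsB P P).1.
Qed.

Lemma injm_taut_val P : 'injm (@taut_val _ _ _ (tobj T) P).
Proof. by apply/injmP=> a b _ _ eq_ab; do 2!apply: val_inj. Qed.

Lemma card_eps_im P (A : {group gT}) :
  A \subset 'N_S(P) -> #|im P A| = #|A|.
Proof.
move=> sAN; rewrite card_injm ?injm_faut_eps ?subsetT //.
rewrite -(card_injm (injm_taut_val P)) ?subsetT //.
by rewrite morphpreK // im_taut_val.
Qed.

Fact eps_im_group_set P (A : {group gT}) : group_set (im P A).
Proof. exact: (groupP (faut (teps T) P @* (taut_val P @*^-1 A))). Qed.
Canonical eps_im_group P (A : {group gT}) := Group (eps_im_group_set P A).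

Lemma eps_im_sub P (A B : {set gT}) :
  A \subset 'N_S(P) -> (im P A \subset im P B) = (A \subset B).
Proof.
move=> sAN; apply/idP/idP=> [sAB | sAB]; last by rewrite morphimS ?morphpreS.
apply/subsetP=> g Ag; have /setIP[Sg /groupVr/normP nPg] := subsetP sAN g Ag.
have tg : g \in transp S P P by rewrite inE Sg nPg /=.
have [a aE] := aut_eps (TMor tg : tmor P P).
have /(subsetP sAB)/eps_imP[h Bh] : a \in im P A.
  by apply/eps_imP; exists (TMor tg).
by rewrite aE => /(tsB P P).1 /(congr1 (@tval _ _ _ _ _ _)) /= ->.
Qed.

Lemma eps_im_proper P (A B : {set gT}) :
    A \subset 'N_S(P) -> B \subset 'N_S(P) ->
  (im P A \proper im P B) = (A \proper B).
Proof. by move=> sAN sBN; rewrite !properE !eps_im_sub. Qed.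

Lemma sub_eps_im P (X : {group aut (tcat T) P}) : X \subset im P 'N_S(P) ->
  exists2 Y : {group gT}, Y \subset 'N_S(P) & im P Y = X.
Proof.
move=> sXN; exists (taut_val P @* (faut (teps T) P @*^-1 X))%G => /=.
  by rewrite -im_taut_val morphimS ?subsetT.
rewrite /eps_im injmK ?injm_taut_val ?subsetT //.
by rewrite morphpreK // (subset_trans sXN) ?morphimS ?subsetT.
Qed.

(** By axiom (C), conjugating the image of g by an automorphism a gives the image of [rho] of a at
    g. *)
Lemma eps_im_normal P : im P P <| [set: aut (tcat T) P].
Proof.
rewrite /normal subsetT; apply/subsetP=> a _; rewrite -groupV inE.
apply/subsetP=> _ /imsetP[b /eps_imP[g Pg bE] ->].
apply/eps_imP; exists (tinner (rv_in a Pg)); first exact: rv_in.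
rewrite conjgE invgK autME (_ : aut_mor (b * a^-1) = b \oc aut_mor a^-1) //.
rewrite bE (@eps_val_eq _ _ _ (tinner Pg)) // ccompA tsC.
rewrite -ccompA; have /andP[_ /eqP->] := aut_inverses a.
by rewrite ccompm1; apply: eps_val_eq.
Qed.

(** * Closure properties of composites of restrictions *)

Section Composites.
Variable X : object (tobj T) -> Prop.
Local Notation good f := (comp_of_restr X f).

(** A restriction of h \oc g splits at the image R of P under g: the isomorphism u from P to R
    restricts g, and f \oc u' restricts h. *)
Lemma comp_of_restr_sub A B (g : Mor A B) : good g ->
  forall P Q (sPA : P \subset A) (sQB : Q \subset B) (f : Mor P Q),
  g \oc inc sPA = inc sQB \oc f -> good f.
Proof.
elim=> {A B g} [A B R a g XR [sAR [sBR resg]] | A B C h g _ IHh _ IHg]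
  P Q sPA sQC f.
  move=> fE; apply: (Restr XR (a := a)).
  exists (subset_trans sPA sAR), (subset_trans sQC sBR).
  rewrite -(inc_comp sPA sAR) -(inc_comp sQC sBR) -ccompA -fE ccompA resg.
  by rewrite ccompA.
move=> fE; have [R [sRB [u [u' [uu' uE]]]]] := mor_factor (g \oc inc sPA).
have /andP[/eqP u'u _] := uu'.
rewrite -(ccompm1 f) -u'u ccompA; apply: CompRestr; last exact: IHg uE.
apply: (IHh _ _ sRB sQC); apply: (iso_epi uu').
by rewrite !ccompA -!ccompA u'u ccompm1 -uE ccompA fE.
Qed.

Lemma comp_of_restr_extend P Q N M (f : Mor P Q) f' (sPN : P \subset N)
    (sQM : Q \subset M) (fbar : Mor N M) :
    (forall A B (g : Mor A B), #|P| < #|A| -> good g) ->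
  #|P| < #|N| -> inverses f f' -> fbar \oc inc sPN = inc sQM \oc f ->
  good f /\ good f'.
Proof.
move=> IH ltPN ff' fbarE; split.
  by apply: comp_of_restr_sub fbarE; apply: IH.
have [R [sRM [u [u' [uu' uE]]]]] := mor_factor fbar.
have sQR : Q \subset R.
  apply/subsetP=> y Qy; have Py := rv_in f' Qy.
  have Ny := subsetP sPN _ Py.
  have <- : rv u (rv f' y) = y; last exact: rv_in.
  rewrite -(rv_inc sRM (rv_in u Ny)) -rv_comp -uE -{1}(rv_inc sPN Py).
  rewrite -rv_comp fbarE rv_comp rv_inc ?rv_in //.
  exact: inverses_rv (inverses_sym ff') Qy.
have /andP[/eqP u'u _] := uu'; have /andP[_ /eqP f'f] := ff'.
apply: (@comp_of_restr_sub _ _ u' _ _ _ sQR sPN).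
  by apply: IH; rewrite -(card_iso u u').
have -> : inc sQR = u \oc inc sPN \oc f'.
  apply: (@mor_mono _ _ _ (inc sRM)); rewrite !ccompA -uE fbarE.
  by rewrite (inc_comp sQR sRM sQM) -ccompA f'f ccompm1.
by rewrite !ccompA u'u ccomp1m.
Qed.

Lemma comp_of_restr_aut P (a : aut (tcat T) P) : X P -> good a.
Proof.
move=> XP; apply: (Restr XP (a := a)); exists (subxx P), (subxx P).
by rewrite eps_val1 // ccomp1m ccompm1.
Qed.

Lemma comp_of_restr_inc P Q (sPQ : P \subset Q) :
  X (top_obj (tobj T)) -> good (inc sPQ).
Proof.
move=> XS; apply: (Restr XS (a := 1)); exists (obj_sub P), (obj_sub Q).
by rewrite aut1E ccomp1m; apply: inc_comp.
Qed.

Lemma comp_of_restr_gen P (A : {set aut (tcat T) P}) a :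
    X (top_obj (tobj T)) -> {in A, forall b, good (aut_mor b)} ->
  a \in <<A>> -> good a.
Proof.
move=> XS goodA /gen_prodgP[n [c Ac ->]].
elim/big_ind: _ => [|b b' gb gb'|i _]; last exact: goodA.
  (* The empty product is the inclusion of P in itself, a restriction of the identity of S. *)
  rewrite aut1E -(@eps_val1 _ (tincl (subxx P))) //.
  exact: comp_of_restr_inc.
by rewrite autME; apply: CompRestr.
Qed.
End Composites.

(** * Isomorphisms to objects with condition (i) of essentiality, and lifting of automorphisms *)

Definition sylow_normalized P := p.-Sylow([set: aut (tcat T) P]) (im P 'N_S(P)).

(** Conjugation by f makes X a p-subgroup of Aut_T(Q), which some b moves into the Sylow subgroup
    N_S(Q); this b is absorbed into the isomorphism. *)
Lemma sylow_align P Q (f : Mor P Q) f' (X : {group aut (tcat T) P}) :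
    sylow_normalized Q -> inverses f f' -> p.-group X ->
  exists (u : Mor P Q) (u' : Mor Q P), inverses u u' /\
    forall a, a \in X -> exists g : tmor Q Q, u \oc aut_mor a \oc u' = ev g.
Proof.
move=> sylQ ff' pX.
have pfX : p.-group (iso_conj ff' @* X) by rewrite morphim_pgroup.
have [b _ /subsetP sfX] := Sylow_subJ sylQ (subsetT _) pfX.
exists (b \oc f), (f' \oc aut_mor b^-1); split.
  exact: inverses_comp ff' (aut_inverses b).
move=> a Xa; have := sfX _ (mem_morphim (iso_conj_morphism ff') (in_setT a) Xa).
rewrite mem_conjg => /eps_imP[g _ gE]; exists g; rewrite -gE.
by rewrite conjgE invgK /= !ccompA.
Qed.

Lemma leq_card_normalizer P Q (M : {group aut (tcat T) P}) (f : Mor P Q) f' :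
    inverses f f' ->
    (forall a, a \in M -> exists g : tmor Q Q, f \oc aut_mor a \oc f' = ev g) ->
  #|M| <= #|'N_S(Q)|.
Proof.
move=> ff' fM; rewrite -(card_eps_im (subxx 'N_S(Q))).
rewrite -(card_injm (injm_iso_conj ff') (subsetT M)) subset_leq_card //.
apply/subsetP=> _ /morphimP[a _ Ma ->]; have [g gE] := fM a Ma.
by apply/eps_imP; exists g; rewrite ?tmor_norm.
Qed.

Lemma eps_val_inc P N (sPN : P \subset N) (g : tmor N N) (h : tmor P P) :
  tval g = tval h -> ev g \oc inc sPN = inc sPN \oc ev h.
Proof.
move=> gh; rewrite -!eps_val_comp; apply: eps_val_eq.
by rewrite /= gh mulg1 mul1g.
Qed.

(** Axiom (II) extends both a and its inverse to N; the extensions are mutually inverse because the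
    inclusion of P in N is an epimorphism. *)
Lemma extend_aut P N (nPN : P <| N) (sPN : P \subset N) (a : aut (tcat T) P) :
    a \in 'N(im P N) ->
  exists b : aut (tcat T) N, b \oc inc sPN = inc sPN \oc a.
Proof.
have ext c : c \in 'N(im P N) ->
    exists d : Mor N N, d \oc inc sPN = inc sPN \oc aut_mor c.
  move=> nc; apply: (extend_iso nPN nPN sPN sPN (aut_inverses c)) => g Ng.
  have [b bE] := aut_eps g.
  have: b ^ c^-1 \in im P N.
    by rewrite memJ_norm ?groupV //; apply/eps_imP; exists g.
  case/eps_imP=> h Nh hE; exists h => //.
  by rewrite -hE conjgE invgK /= -bE ccompA.
move=> na; have [b bE] := ext a na.
have [b' b'E] := ext a^-1 (groupVr na).
have /andP[/eqP a'a /eqP aa'] := aut_inverses a.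
have bb' : inverses b b'.
  apply/andP; split; apply/eqP/(inc_epi nPN (sPN := sPN)).
    by rewrite -ccompA bE ccompA b'E -ccompA a'a ccomp1m ccompm1.
  by rewrite -ccompA b'E ccompA bE -ccompA aa' ccomp1m ccompm1.
by have [c [cE _]] := aut_of_inverses bb'; exists c; rewrite cE.
Qed.

(** Extensions to N are unique by [inc_epi], so choosing one for each element of M is a
    homomorphism, and its image is a p-group. *)
Lemma lift_aut_group P N (nPN : P <| N) (sPN : P \subset N)
    (M : {group aut (tcat T) P}) :
    M \subset 'N(im P N) -> p.-group M ->
  exists2 B : {group aut (tcat T) N}, p.-group B & forall a, a \in M ->
    exists2 b, b \in B & aut_mor b \oc inc sPN = inc sPN \oc aut_mor a.
Proof.
move=> nM pM.
(* The default 1 is never taken on M, by [extend_aut]. *)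
pose lift a := odflt 1
  [pick b : aut (tcat T) N | b \oc inc sPN == inc sPN \oc aut_mor a].
have liftE a : a \in M -> lift a \oc inc sPN = inc sPN \oc a.
  move=> Ma; rewrite /lift; case: pickP => [b /eqP // | no_b].
  have [b bE] := extend_aut nPN sPN (subsetP nM a Ma).
  by have /eqP := no_b b.
have liftM : {in M &, {morph lift : a b / a * b}}.
  move=> a b Ma Mb; apply/val_inj/(inc_epi nPN (sPN := sPN)).
  have -> : aut_mor (lift a * lift b) \oc inc sPN =
      lift a \oc (lift b \oc inc sPN).
    by rewrite ccompA.
  by rewrite !liftE ?groupM // autME !ccompA liftE.
exists (Morphism liftM @* M)%G; first exact: morphim_pgroup.
by move=> a Ma; exists (lift a); [apply: mem_morphim | apply: liftE].
Qed.

(** * Every object is isomorphic to one whose normalizer in S is Sylow *)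

Section PGroup.
Hypotheses (p_pr : prime p) (pS : p.-group S).

Lemma sylow_normalized_top : sylow_normalized (top_obj (tobj T)).
Proof.
rewrite /sylow_normalized (setIidPl _); first exact: tsI.
exact: normG.
Qed.

Lemma proper_normalizer P : P != S :> {group gT} -> P \proper 'N_S(P).
Proof.
move=> neqPS; apply: nilpotent_proper_norm (pgroup_nil pS) _.
by rewrite properEneq obj_sub andbT; apply: contraNneq neqPS => /val_inj->.
Qed.

Fact normalizer_obj_subproof P : 'N_S(P)%G \in objects (tobj T).
Proof.
by apply: objects_over (objP P) _ _; rewrite ?subsetIl // subsetI obj_sub normG.
Qed.
Definition normalizer_obj P : object (tobj T) :=
  Object (normalizer_obj_subproof P).

Lemma normalizer_obj_normal P : P <| normalizer_obj P.
Proof. by rewrite /normal subsetI obj_sub normG subsetIr. Qed.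

Lemma pgroup_eps_im P : p.-group (im P 'N_S(P)).
Proof.
rewrite /pgroup card_eps_im //; apply: pgroupS pS; exact: subsetIl.
Qed.

(** The object Q is the image of P under an isomorphism f from N_S(P) to some R that carries the
    lifted group into N_S(R). Conjugation then embeds M in N_S(Q), so the growth of normalizers in
    p-groups gives the strict inequality. *)
Lemma larger_normalizer P :
    (forall N, #|P| < #|N| -> exists Q (f : Mor N Q) f',
       inverses f f' /\ sylow_normalized Q) ->
    P != S :> {group gT} -> ~~ sylow_normalized P ->
  exists Q (f : Mor P Q) f', inverses f f' /\ #|'N_S(P)| < #|'N_S(Q)|.
Proof.
move=> IH neqPS notSyl; pose N := normalizer_obj P.
have nPN : P <| N := normalizer_obj_normal P; have sPN := normal_sub nPN.
have [X sylX sNX] := Sylow_superset (subsetT (im P 'N_S(P))) (pgroup_eps_im P).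
have pX := pHall_pgroup sylX.
pose M := 'N_X(im P 'N_S(P))%G.
have ltNM : #|'N_S(P)| < #|M|.
  rewrite -(card_eps_im (subxx 'N_S(P))) proper_card //.
  apply: nilpotent_proper_norm (pgroup_nil pX) _.
  rewrite properEneq sNX andbT; apply: contraNneq notSyl => eqNX.
  by rewrite /sylow_normalized eqNX.
have [|B pB liftB] := @lift_aut_group P N nPN sPN M (subsetIr _ _).
  by apply: pgroupS pX; apply: subsetIl.
have [|R [f0 [f0' [ff0 sylR]]]] := IH N.
  by rewrite proper_card // proper_normalizer.
have [f [f' [ff' fB]]] := sylow_align sylR ff0 pB.
have [Q [sQR [u [u' [uu' uE]]]]] := mor_factor (f \oc inc sPN).
exists Q, u, u'; split=> //; apply: leq_trans ltNM _.
apply: (leq_card_normalizer uu') => a Ma.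
have [b Bb bE] := liftB a Ma; have [g gE] := fB b Bb.
have /andP[/eqP u'u _] := uu'; have /andP[/eqP f'f _] := ff'.
(* On R the element g acts as the transport of b. Restricted to Q this is the transport of a, so g
   sends Q into itself. *)
have eq_gu : ev g \oc inc sQR = inc sQR \oc (u \oc aut_mor a \oc u').
  apply: (iso_epi uu'); rewrite -!ccompA u'u ccompm1 -uE -gE.
  rewrite -!ccompA (ccompA f') f'f ccomp1m bE.
  by rewrite !ccompA -uE.
have tg : tval g \in transp S Q Q.
  have /setIP[Sg _] := tmor_norm g; rewrite inE Sg.
  apply/subsetP=> _ /imsetP[x Qx ->]; rewrite conjgE invgK.
  rewrite mulgA -(rv_eps g (subsetP sQR x Qx)) -(rv_inc sQR Qx) -rv_comp eq_gu.
  by rewrite rv_comp rv_inc ?rv_in.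
exists (TMor tg); apply: (@mor_mono _ _ _ (inc sQR)).
by rewrite -eq_gu; apply: eps_val_inc.
Qed.

Lemma exists_sylow_normalized P :
  exists Q (f : Mor P Q) f', inverses f f' /\ sylow_normalized Q.
Proof.
have [m] := ubnP (#|S| - #|P|); elim: m P => // m IHm P lePm.
(* The outer induction lets |P| grow; the inner one keeps |P| fixed up to isomorphism and lets
   |N_S(P)| grow. *)
have [k] := ubnP (#|S| - #|'N_S(P)|); elim: k P lePm => // k IHk P lePm lePk.
have [sylP | notSyl] := boolP (sylow_normalized P).
  by exists P, (cid _ P), (cid _ P); rewrite inverses_id.
have neqPS : P != S :> {group gT}.
  apply: contraNneq notSyl => eqPS.
  by rewrite (@object_inj P (top_obj _) eqPS) sylow_normalized_top.
have ltPS: #|P| < #|S|.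
  apply: leq_trans (proper_card (proper_normalizer neqPS)) _.
  by rewrite subset_leq_card ?subsetIl.
have [|Q [f [f' [ff' ltPQ]]]] := larger_normalizer _ neqPS notSyl.
  move=> N ltPN; apply: IHm; rewrite ltnS in lePm.
  exact: leq_trans (ltn_sub2l ltPS ltPN) lePm.
have [||R [g [g' [gg' sylR]]]] := IHk Q.
- by rewrite -(card_iso f f').
- rewrite ltnS in lePk; apply: leq_trans lePk; apply: (ltn_sub2l _ ltPQ).
  by apply: leq_trans ltPQ _; rewrite subset_leq_card ?subsetIl.
by exists R, (g \oc f), (f' \oc g'); split=> //; apply: inverses_comp ff' gg'.
Qed.

(** * The inductive step at an object other than S *)

Section Larger.
Variables (P : object (tobj T)) (X : object (tobj T) -> Prop).
Hypotheses (neqPS : P != S :> {group gT}) (XS : X (top_obj (tobj T))).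
Hypothesis IH : forall A B (g : Mor A B), #|P| < #|A| -> comp_of_restr X g.
Local Notation good f := (comp_of_restr X f).

(** Aligning the whole of N_S(P) with N_S(Q) allows axiom (II) to extend the isomorphism to N_S(P),
    which is strictly larger than P. *)
Lemma comp_of_restr_normalize Q (f : Mor P Q) f' :
    inverses f f' -> sylow_normalized Q ->
  exists (u : Mor P Q) (u' : Mor Q P), [/\ inverses u u', good u & good u'].
Proof.
move=> ff' sylQ.
have [u [u' [uu' uN]]] := sylow_align sylQ ff' (pgroup_eps_im P).
have nPN := normalizer_obj_normal P; have nQM := normalizer_obj_normal Q.
have sPN := normal_sub nPN; have sQM := normal_sub nQM.
have [|fbar fbarE] := extend_iso nPN nQM sPN sQM uu'.
  move=> g Ng; have [a aE] := aut_eps g.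
  have [|h hE] := uN a; first by apply/eps_imP; exists g.
  by exists h; rewrite ?tmor_norm // -aE.
have ltPN : #|P| < #|normalizer_obj P| := proper_card (proper_normalizer neqPS).
have [good_u good_u'] := comp_of_restr_extend IH ltPN uu' fbarE.
by exists u, u'.
Qed.

Lemma comp_of_restr_sylow_aut (a : aut (tcat T) P) : sylow_normalized P ->
  (* Conjugation by b^-1 on the right sends Y to b Y b^-1, the condition under which axiom (II)
     extends b to a map from Y to N_S(P). *)
  (essential P -> X P) -> good a.
Proof.
move=> sylP XP; pose A := [set b : aut (tcat T) P |
  [exists Y : {group gT}, [&& P \proper Y, Y \subset 'N_S(P)
                            & im P Y :^ b^-1 \subset im P 'N_S(P)]]].
have goodA : {in A, forall b, good (aut_mor b)}.
  move=> b; rewrite inE => /existsP[Y0 /and3P[ltPY sYN sbYN]].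
  have [sYS nPY0] := subsetIP sYN.
  have DY : Y0 \in objects (tobj T).
    exact: objects_over (objP P) (proper_sub ltPY) sYS.
  pose Y := Object DY; have sPY : P \subset Y := proper_sub ltPY.
  have nPY : P <| Y by rewrite /normal sPY.
  have nPN := normalizer_obj_normal P; have sPN := normal_sub nPN.
  have [|fbar fbarE] := extend_iso nPY nPN sPY sPN (aut_inverses b).
    move=> g Yg; have [c cE] := aut_eps g.
    have: c ^ b^-1 \in im P 'N_S(P).
      by apply: (subsetP sbYN); rewrite memJ_conjg; apply/eps_imP; exists g.
    case/eps_imP=> h Nh hE; exists h => //.
    by rewrite -hE conjgE invgK /= -cE ccompA.
  have ltPYc : #|P| < #|Y| := proper_card ltPY.
  by have [] := comp_of_restr_extend IH ltPYc (aut_inverses b) fbarE.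
have [G_A | ltAG] := eqVproper (subsetT <<A>>).
  by apply: comp_of_restr_gen XS goodA _; rewrite G_A.
apply/comp_of_restr_aut/XP; split=> //; exists (<<A>> / im P P)%G.
have ltEN : im P P \proper im P 'N_S(P).
  by rewrite eps_im_proper ?proper_normalizer // subsetI obj_sub normG.
apply: strongly_embedded_quotient p_pr (eps_im_normal P) ltEN sylP ltAG _.
(* The criterion takes Y to x^-1 Y x, so it is x^-1 that lies in the generating set; closure under
   inverses then gives x. *)
move=> Y x ltEY sYN _ sYxN; rewrite -groupV mem_gen // inE invgK.
have [Z sZN ZE] := sub_eps_im sYN.
apply/existsP; exists Z; rewrite sZN ZE sYxN !andbT.
by rewrite -(@eps_im_proper P) // ?ZE // subsetI obj_sub normG.
Qed.
End Larger.

Lemma comp_of_restr_all (X : object (tobj T) -> Prop) :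
    X (top_obj (tobj T)) -> (forall P, essential P -> X P) ->
  forall P Q (f : Mor P Q), comp_of_restr X f.
Proof.
move=> XS Xess P; have [m] := ubnP (#|S| - #|P|).
elim: m P => // m IHm P lePm Q f.
have [R [sRQ [{f}f [f' [ff' ->]]]]] := mor_factor f.
apply: CompRestr; first exact: comp_of_restr_inc.
have [eqPS | neqPS] := eqVneq (P : {group gT}) S.
  have eqRS : R = S :> {group gT}.
    by apply/val_inj/eqP; rewrite eqEcard obj_sub -(card_iso f f') eqPS leqnn.
  have /object_inj eqRP : R = P :> {group gT} by rewrite eqPS.
  have /object_inj eqPtop : P = top_obj (tobj T) :> {group gT} by [].
  subst R; have [a [<- _]] := aut_of_inverses ff'.
  by apply: comp_of_restr_aut; rewrite eqPtop.
have ltPS : #|P| < #|S| by rewrite proper_card // properEneq neqPS obj_sub.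
(* The induction hypothesis is needed at P, at R and at N, which all have the same order. *)
have IH N : #|P| <= #|N| ->
    forall A B (g : Mor A B), #|N| < #|A| -> comp_of_restr X g.
  move=> lePN A B g ltNA; apply: IHm; rewrite ltnS in lePm.
  by apply: leq_trans lePm; apply: (ltn_sub2l ltPS); apply: leq_ltn_trans ltNA.
have neqS N : #|P| = #|N| -> N != S :> {group gT}.
  by move=> eqPN; apply: contraTneq ltPS => eqNS; rewrite eqPN eqNS ltnn.
(* One N serves both ends, since R is isomorphic to N through P. The morphism v \oc f \oc u' is then
   an automorphism a of N, and f is recovered from it. *)
have [N [g [g' [gg' sylN]]]] := exists_sylow_normalized P.
have eqPN := card_iso g g'; have eqPR := card_iso f f'.
have [u [u' [uu' good_u good_u']]] :=
  comp_of_restr_normalize neqPS (IH P (leqnn _)) gg' sylN.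
have [|v [v' [vv' good_v good_v']]] := comp_of_restr_normalize
  (neqS R eqPR) (IH R _) (inverses_comp (inverses_sym ff') gg') sylN.
  by rewrite eqPR.
have [a [aE _]] := aut_of_inverses
  (inverses_comp (inverses_comp (inverses_sym uu') ff') vv').
have -> : f = v' \oc aut_mor a \oc u.
  have /andP[/eqP u'u _] := uu'; have /andP[/eqP v'v _] := vv'.
  by rewrite aE !ccompA v'v ccomp1m -ccompA u'u ccompm1.
apply: CompRestr good_u; apply: CompRestr good_v' _.
apply: (comp_of_restr_sylow_aut (neqS N eqPN)) => //; last exact: Xess.
by apply: IH; rewrite eqPN.
Qed.

End PGroup.
End Transporter.

Theorem theorem3p4 (p : nat) (gT : finGroupType) (S : {group gT})
    (F : fusion_system S) (T : transporter_system p F) :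
  prime p -> p.-group S ->
  forall (P Q : object (tobj T)) (f : mor (tcat T) P Q),
    comp_of_restr (fun R => R = top_obj (tobj T) \/ essential R) f.
Proof.
move=> p_pr pS; apply: comp_of_restr_all => // [|P essP]; [by left | by right].
Qed.
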